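(* Let $\varepsilon>0$. For every sufficiently large $n$ there is a standard set $A\subset\mathbb Z_2^n$ such that \[ \lambda(A)<\varepsilon\quad\text{and}\quad \lambda^\pm(A)>\tfrac12-\varepsilon. \]
   Context: For a finite commutative group $G$ (written additively), a set $A\subset G$ is a standard set if $A=-A$ and $0\in A$. A character of $G$ is a homomorphism $\gamma:G\to\{z\in\mathbb C:|z|=1\}$; $\hat G$ is the group of characters and $\mathbf 1$ the principal character. For $f:G\to\mathbb R$, $\hat f(\gamma)=\sum_{x\in G}\gamma(x)f(x)$. For a standard set $A$, let $\mathcal S(A)$ be the set of functions $f:G\to\mathbb R$, not identically zero, with $f=0$ on $G\setminus A$, and $\mathcal S^\pm(A)$ the set of functions $f:G\to\mathbb R$, not identically zero, with $f\le 0$ on $G\setminus A$ and $f\ge 0$ on $A$. Then $\lambda(A)=\min\{f(0)/\hat f(\mathbf 1): f\in\mathcal S(A),\ \hat f(\gamma)\ge 0\ \forall\gamma\in\hat G\}$ and $\lambda^\pm(A)$ is defined the same way with $\mathcal S^\pm(A)$ in place of $\mathcal S(A)$. *)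

(* Defs.v *)
From HB Require Import structures.
From mathcomp Require Export all_boot all_order all_algebra.
From mathcomp Require Export complex.
From mathcomp Require Export boolp classical_sets reals.

Set Implicit Arguments.
Unset Strict Implicit.
Unset Printing Implicit Defensive.

Import Order.TTheory GRing.Theory Num.Theory.

Local Open Scope ring_scope.
Local Open Scope complex_scope.

Section Turan.
Variables (R : realType) (G : finZmodType).
Implicit Types (A : {set G}) (f : G -> R) (gamma : G -> R[i]).

Definition standard A : Prop :=
  A = [set - x | x in A]%SET /\ 0 \in A.

Definition character gamma : Prop :=
  (forall x y, gamma (x + y) = gamma x * gamma y) /\
  (forall x, `|gamma x| = 1).

Definition principal : G -> R[i] := fun=> 1.

Definition fourier f gamma : R[i] := \sum_(x : G) gamma x * (f x)%:C.

(* The order on R[i] is partial: 0 <= z means that z is real and nonnegative. *)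
Definition fourier_nonneg f : Prop :=
  forall gamma, character gamma -> 0 <= fourier f gamma.

Definition classS A f : Prop :=
  (exists x, f x != 0) /\ (forall x, x \notin A -> f x = 0).

Definition classSpm A f : Prop :=
  [/\ exists x, f x != 0,
      forall x, x \notin A -> f x <= 0 &
      forall x, x \in A -> 0 <= f x].

(* Division by zero yields 0 in the library, so the functions whose transform
   vanishes at the principal character (where the quotient is +oo, as f 0 > 0
   for every admissible f) have to be excluded explicitly. *)
Definition ratios (S : (G -> R) -> Prop) : set R :=
  [set r | exists f, [/\ S f, fourier_nonneg f, fourier f principal != 0 &
                         r%:C = (f 0)%:C / fourier f principal]]%classic.

Definition is_minimum (E : set R) (m : R) : Prop :=
  E m /\ (forall r, E r -> m <= r).

(* Relational, so that asserting [is_lambda A l] includes the existence of the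
   minimum; l is then unique. *)
Definition is_lambda A (l : R) : Prop := is_minimum (ratios (classS A)) l.

Definition is_lambda_pm A (l : R) : Prop := is_minimum (ratios (classSpm A)) l.

End Turan.

(* Main.v *)
(* The set A consists of 0 and of the vectors within Hamming distance d of the
   all-ones vector, where d is a small multiple of n.

   If f is in S^pm(A), pair it with the sum of the n coordinate characters plus
   n - 2 d. This test function is nonpositive on A away from 0 and nonnegative
   off A, so the pairing is at most (2 n - 2 d) f(0); it is at least
   (n - 2 d) sum_x f(x) because hat f >= 0. Hence lambda^pm(A) >= 1/2 - d/n.

   For lambda(A), the operator f |-> sum_i f(. - e_i) acts on Fourier transforms
   as multiplication by s(gamma) = sum_i gamma(e_i). A polynomial p of degree d
   in this operator maps the point mass at the all-ones vector u to a function
   supported on A, with transform gamma(u) p(s(gamma)). Now s = n for the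
   principal character and -n <= s <= n - 2 for the others, so that for
   p(s) = T_d((s + 2) / n), T_d the Chebyshev polynomial, adding the point mass
   at 0 makes the transform nonnegative, and its value at the principal
   character is 1 + T_d(1 + 2 / n) >= 2 + 2 d^2 / n.

   The minima exist by compactness: after normalising f(0) = 1, Fourier
   inversion gives |f| <= 1. *)

Require Import Defs.
From mathcomp Require Import all_boot all_order all_algebra.
From mathcomp Require Import reals.
From mathcomp Require Import topology normedtype derive ring lra zify.

Set Implicit Arguments.
Unset Strict Implicit.
Unset Printing Implicit Defensive.

Import Order.TTheory GRing.Theory Num.Theory.
Import numFieldNormedType.Exports.

Local Open Scope ring_scope.

Definition point_mass (R : pzSemiRingType) (T : eqType) (y : T) : T -> R :=
  fun x => (x == y)%:R.
Arguments point_mass {R T} y x.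

Definition pairing (R : pzSemiRingType) (T : finType) (g f : T -> R) : R :=
  \sum_x g x * f x.

Section Pairing.
Variables (R : comPzRingType) (T : finType).
Implicit Types f g h : T -> R.

Lemma pairingC g f : pairing g f = pairing f g.
Proof. by apply: eq_bigr => x _; rewrite mulrC. Qed.

Lemma pairingDr g f h : pairing g (f \+ h) = pairing g f + pairing g h.
Proof. by rewrite -big_split; apply: eq_bigr => x _; rewrite mulrDr. Qed.

Lemma pairingNr g f : pairing g (\- f) = - pairing g f.
Proof. by rewrite -sumrN; apply: eq_bigr => x _; rewrite mulrN. Qed.

Lemma pairingZr g (a : R) f : pairing g (a \*o f) = a * pairing g f.
Proof. by rewrite mulr_sumr; apply: eq_bigr => x _; rewrite /= mulrCA. Qed.

Lemma pairing_sumr g (I : finType) (F : I -> T -> R) :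
  pairing g (fun x => \sum_i F i x) = \sum_i pairing g (F i).
Proof.
by rewrite exchange_big; apply: eq_bigr => x _; rewrite mulr_sumr.
Qed.

Lemma pairing_point_mass g y : pairing g (point_mass y) = g y.
Proof.
rewrite /pairing (bigD1 y) //= /point_mass eqxx mulr1 big1 ?addr0 // => x.
by move/negPf->; rewrite mulr0.
Qed.

Lemma pairing1l f : pairing (fun=> 1) f = \sum_x f x.
Proof. by apply: eq_bigr => x _; rewrite mul1r. Qed.

End Pairing.

Section DualCone.
Variables (R : realType) (T : finType).
Implicit Types (c f g : T -> R) (L : set (T -> R)) (P N : {set T}).

Local Notation function_space := (prod_topology (fun _ : T => R)).

Definition dual_cone L : set (T -> R) :=
  [set f | forall g, L g -> 0 <= pairing g f]%classic.

Lemma dual_coneU L1 L2 f :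
  dual_cone (L1 `|` L2)%classic f <-> dual_cone L1 f /\ dual_cone L2 f.
Proof.
split=> [Lf|[L1f L2f] g []]; [|exact: L1f|exact: L2f].
by split=> g Lg; apply: Lf; [left|right].
Qed.

Definition sign_constraints P N : set (T -> R) :=
  [set g | (exists2 x, x \in P & g = point_mass x) \/
           (exists2 x, x \in N & g = \- point_mass x)]%classic.

Lemma dual_cone_sign_constraints P N f :
  dual_cone (sign_constraints P N) f <->
  (forall x, x \in P -> 0 <= f x) /\ (forall x, x \in N -> f x <= 0).
Proof.
split=> [fPN|[fP fN] g].
  split=> x xPN.
    by rewrite -(pairing_point_mass f) pairingC; apply: fPN; left; exists x.
  rewrite -oppr_ge0 -(pairing_point_mass f) -pairingNr pairingC.
  by apply: fPN; right; exists x.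
rewrite pairingC => -[[x xP ->]|[x xN ->]].
  by rewrite pairing_point_mass fP.
by rewrite pairingNr pairing_point_mass oppr_ge0 fN.
Qed.

Lemma pairing_continuous c :
  continuous (fun f : function_space => pairing c f).
Proof.
have term_continuous x : continuous (fun f : function_space => c x * f x).
  move=> f; apply: (cvg_comp (fun f : function_space => f x) ( *%R (c x))).
    exact: (@proj_continuous T (fun=> R) x f).
  exact: mulrl_continuous.
exact: (continuous_big (@add_continuous R) (fun x _ => term_continuous x)).
Qed.

Lemma dual_cone_closed L : closed (dual_cone L : set function_space).
Proof.
rewrite (_ : dual_cone L = \bigcap_(g in L) [set f | 0 <= pairing g f])%classic.
  apply: closed_bigI => g _.
  apply: (@preimage_closed function_space R (pairing g)
    [set y | 0 <= y]%classic).
    by move=> f _; exact: pairing_continuous.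
  exact: closed_ge.
by apply/seteqP; split.
Qed.

Lemma dual_cone_slice_compact L e :
  (forall f, dual_cone L f -> forall x, `|f x| <= f e) ->
  compact (dual_cone L `&` [set f | f e = 1] : set function_space)%classic.
Proof.
move=> Le.
apply: (@subclosed_compact function_space _
  [set f | forall x, `[-1, 1] (f x)]%classic).
- apply: closedI; first exact: dual_cone_closed.
  apply: (@preimage_closed function_space R (fun f => f e)
    [set y | y = 1]%classic).
    by move=> f _; exact: (@proj_continuous T (fun=> R) e f).
  exact: closed_eq.
- apply: (@tychonoff T (fun=> R) (fun=> `[-1, 1]%classic)) => _.
  exact: segment_compact.
- move=> f [Lf fe] x /=; rewrite in_itv /= -ler_norml -fe; exact: Le.
Qed.

Lemma dual_cone_ratio_max L e c :
  (forall f, dual_cone L f -> forall x, `|f x| <= f e) ->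
  (exists2 f, dual_cone L f & f e = 1) ->
  exists f0, [/\ dual_cone L f0, f0 e = 1 &
    forall f, dual_cone L f -> pairing c f <= f e * pairing c f0].
Proof.
move=> Le [h Lh he].
pose slice : set function_space := (dual_cone L `&` [set f | f e = 1])%classic.
have slice_nonempty : (slice !=set0)%classic by exists h.
have pairing_slice_continuous : {within slice, continuous (pairing c)}%classic.
  by apply: continuous_subspaceT; exact: pairing_continuous.
have [f0 /set_mem[Lf0 f0e] f0max] := compact_EVT_max slice_nonempty
  (dual_cone_slice_compact Le) pairing_slice_continuous.
exists f0; split => // f Lf.
have [fe0|fe_neq0] := eqVneq (f e) 0.
  have f_eq0 x : f x = 0.
    by apply/eqP; rewrite -normr_le0 -fe0; exact: Le.
  by rewrite fe0 mul0r /pairing big1 // => x _; rewrite f_eq0 mulr0.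
have fe_gt0 : 0 < f e by rewrite lt_def fe_neq0 (le_trans _ (Le f Lf e)).
have := f0max ((f e)^-1 \*o f); rewrite pairingZr ler_pdivrMl //; apply.
apply/mem_set; split=> [g Lg|]; last exact: mulVf.
by rewrite pairingZr mulr_ge0 ?Lf // invr_ge0 ltW.
Qed.

End DualCone.

Definition unitary_character (R : numDomainType) (G : nmodType) (g : G -> R) :=
  (forall x y, g (x + y) = g x * g y) /\ (forall x, `|g x| = 1).

Section UnitaryCharacters.
Variables (R : numDomainType) (G : nmodType).
Implicit Types g : G -> R.

Lemma unitary_character_const1 : unitary_character (fun _ : G => 1 : R).
Proof. by split=> [x y|x]; rewrite ?mulr1 ?normr1. Qed.

Lemma unitary_character0 g : unitary_character g -> g 0 = 1.
Proof.
move=> [gM g1]; have g0 : g 0 != 0 by rewrite -normr_eq0 g1 oner_eq0.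
by apply: (mulfI g0); rewrite -gM addr0 mulr1.
Qed.

End UnitaryCharacters.

Section FourierTransform.
Variables (R : realType) (G : finZmodType).
Implicit Types f g : G -> R.
Local Open Scope complex_scope.

Lemma normc_real (a : R) : `|a%:C| = `|a|%:C.
Proof. by rewrite normc_def /= expr0n addr0 sqrtr_sqr. Qed.

Lemma unitary_character_complex g :
  unitary_character g -> character (fun x => (g x)%:C).
Proof.
move=> [gM g1]; split=> [x y|x]; first by rewrite gM rmorphM.
by rewrite normc_real g1.
Qed.

Lemma fourier_real f g : fourier f (fun x => (g x)%:C) = (pairing g f)%:C.
Proof.
by rewrite /fourier rmorph_sum; apply: eq_bigr => x _; rewrite rmorphM.
Qed.

Lemma fourier_nonneg_pairing f g :
  fourier_nonneg f -> unitary_character g -> 0 <= pairing g f.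
Proof.
move=> fhat_ge0 /unitary_character_complex/fhat_ge0.
by rewrite fourier_real lecR.
Qed.

Lemma fourier_principal f : fourier f (@principal R G) = (\sum_x f x)%:C.
Proof. by rewrite -pairing1l -fourier_real. Qed.

Lemma ratiosP (S : (G -> R) -> Prop) r : ratios S r <->
  exists f, [/\ S f, fourier_nonneg f, 0 < \sum_x f x & r = f 0 / \sum_x f x].
Proof.
split=> -[f]; rewrite ?fourier_principal.
  move=> [Sf fhat_ge0 sum_neq0 rE]; exists f; split => //.
    rewrite lt_def; apply/andP; split.
      by apply: contraNneq sum_neq0 => ->.
    rewrite -pairing1l; apply: fourier_nonneg_pairing fhat_ge0 _.
    exact: unitary_character_const1.
  by apply: complexI; rewrite rE fmorph_div.
move=> [Sf fhat_ge0 sum_gt0 ->]; exists f.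
rewrite fourier_principal; split => //.
  by rewrite fmorph_eq0 gt_eqF.
by rewrite fmorph_div.
Qed.

End FourierTransform.

Section ExponentTwo.
Variables (R : realType) (G : finZmodType).
Hypothesis addxx : forall x : G, x + x = 0.
Local Open Scope complex_scope.

Lemma oppr_exponent2 (x : G) : - x = x.
Proof. by apply/eqP; rewrite eq_sym -addr_eq0 addxx. Qed.

Lemma standard_exponent2 (A : {set G}) : 0 \in A -> standard A.
Proof.
split=> //; rewrite -[LHS]imset_id; apply: eq_imset => x.
exact/esym/oppr_exponent2.
Qed.

Lemma character_real gamma : @character R G gamma ->
  exists2 g, unitary_character g & gamma = (fun x => (g x)%:C).
Proof.
move=> gammaP; have [gM g1] : unitary_character gamma := gammaP.
have gE x : (complex.Re (gamma x))%:C = gamma x.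
  have : gamma x ^+ 2 == 1.
    by rewrite expr2 -gM addxx (unitary_character0 gammaP).
  by rewrite sqrf_eq1 => /orP[] /eqP->; rewrite ?raddfN.
exists (fun x => complex.Re (gamma x)); last by apply/funext.
by split=> [x y|x]; apply: complexI; rewrite ?rmorphM -?normc_real /= !gE.
Qed.

Lemma fourier_nonneg_exponent2 (f : G -> R) :
  fourier_nonneg f <-> dual_cone (@unitary_character R G) f.
Proof.
split=> [fhat_ge0 g|fhat_ge0 gamma /character_real[g gP ->]].
  exact: fourier_nonneg_pairing.
by rewrite fourier_real lecR fhat_ge0.
Qed.

End ExponentTwo.

Fixpoint chebyshev (R : nzRingType) k : {poly R} :=
  if k is k1.+1 then
    if k1 is k2.+1 then 'X * chebyshev R k1 *+ 2 - chebyshev R k2 else 'X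
  else 1.

Section Chebyshev.
Variable R : comNzRingType.

Lemma chebyshevSS k :
  chebyshev R k.+2 = 'X * chebyshev R k.+1 *+ 2 - chebyshev R k.
Proof. by []. Qed.

Lemma horner_chebyshevSS k z :
  (chebyshev R k.+2).[z] =
  2 * z * (chebyshev R k.+1).[z] - (chebyshev R k).[z].
Proof. by rewrite chebyshevSS !hornerE; ring. Qed.

Lemma size_chebyshev k : (size (chebyshev R k) <= k.+1)%N.
Proof.
elim/ltn_ind: k => -[|[|k]] IH; [by rewrite size_poly1|by rewrite size_polyX|].
apply/leq_sizeP => -[//|j] jk; rewrite chebyshevSS !coefE /=.
rewrite !nth_default ?mul0rn ?subr0 //.
  by rewrite (leq_trans (IH k _)) // ltnW // ltnW.
by rewrite (leq_trans (IH k.+1 _)).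
Qed.

(* [u] is the value at [z] of the Chebyshev polynomial [U_(k-1)] of the second
   kind. *)
Lemma chebyshev_pell k z : exists u,
  (chebyshev R k).[z] ^+ 2 + (1 - z ^+ 2) * u ^+ 2 = 1 /\
  (chebyshev R k.+1).[z] = z * (chebyshev R k).[z] - (1 - z ^+ 2) * u.
Proof.
elim: k => [|k [u [pell next]]].
  by exists 0; rewrite hornerX hornerC; split; ring.
exists ((chebyshev R k).[z] + z * u); rewrite horner_chebyshevSS next.
by split; [rewrite -[RHS]pell|]; ring.
Qed.

End Chebyshev.

Section ChebyshevBounds.
Variable R : realDomainType.

Lemma chebyshev_le1 k (z : R) : `|z| <= 1 -> `|(chebyshev R k).[z]| <= 1.
Proof.
move=> z1; have [u [pell _]] := chebyshev_pell k z.
rewrite -(@ler_sqr _ `|_|) ?nnegrE // real_normK ?num_real // expr1n -pell.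
rewrite lerDl mulr_ge0 ?sqr_ge0 // subr_ge0.
by rewrite -real_normK ?num_real // expr_le1.
Qed.

Lemma chebyshev_growth k (t : R) : 0 <= t ->
  1 + k%:R ^+ 2 * t <= (chebyshev R k).[1 + t].
Proof.
move=> t0; pose T j := (chebyshev R j).[1 + t].
suff : 1 + k%:R ^+ 2 * t <= T k /\ (2 * k%:R + 1) * t <= T k.+1 - T k by case.
elim: k => [|k [T_ge increment_ge]].
  by rewrite /T hornerC hornerX; split; lra.
have TS_ge : 1 + k.+1%:R ^+ 2 * t <= T k.+1 by rewrite -natr1; lra.
split => //; rewrite [T k.+2]horner_chebyshevSS -/(T _) -/(T _) -natr1.
have : 0 <= t * (T k.+1 - 1).
  rewrite mulr_ge0 // subr_ge0 (le_trans _ TS_ge) // lerDl mulr_ge0 //.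
  exact: sqr_ge0.
by lra.
Qed.

End ChebyshevBounds.

Section RescaledChebyshev.
Variables (R : realFieldType) (n d : nat).

Definition rescaled_chebyshev : {poly R} :=
  chebyshev R d \Po (n%:R^-1 *: ('X + 2%:P)).

Lemma size_rescaled_chebyshev : (size rescaled_chebyshev <= d.+1)%N.
Proof.
rewrite (leq_trans (size_comp_poly_leq _ _)) // ltnS -[leqRHS]muln1 leq_mul //.
  by rewrite -subn1 leq_subLR add1n size_chebyshev.
have := size_scale_leq n%:R^-1 ('X + 2%:P : {poly R}).
by rewrite size_XaddC; case: (size _) => [|[|[]]].
Qed.

Lemma horner_rescaled_chebyshev s :
  rescaled_chebyshev.[s] = (chebyshev R d).[(s + 2) / n%:R].
Proof. by rewrite horner_comp !hornerE mulrC. Qed.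

Hypothesis n_gt0 : (0 < n)%N.

Lemma rescaled_chebyshev_le1 s :
  - n%:R <= s <= n%:R - 2 -> `|rescaled_chebyshev.[s]| <= 1.
Proof.
move=> /andP[s_ge s_le]; have n0 : 0 < n%:R :> R by rewrite ltr0n.
rewrite horner_rescaled_chebyshev chebyshev_le1 // ler_norml.
by rewrite ler_pdivlMr // ler_pdivrMr //; apply/andP; split; lra.
Qed.

Lemma rescaled_chebyshev_growth :
  1 + d%:R ^+ 2 * (2 / n%:R) <= rescaled_chebyshev.[n%:R].
Proof.
rewrite horner_rescaled_chebyshev [(_ + 2) / _]mulrDl.
by rewrite divff ?pnatr_eq0 -?lt0n // chebyshev_growth // divr_ge0.
Qed.

End RescaledChebyshev.

Definition poly_op (R : nzSemiRingType) (T : Type) (p : {poly R})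
    (A : (T -> R) -> T -> R) (f : T -> R) : T -> R :=
  fun x => \sum_(k < size p) p`_k * iter k A f x.

Definition cayley_adjacency (R : nmodType) (G : zmodType) (I : finType)
    (e : I -> G) (f : G -> R) : G -> R :=
  fun x => \sum_i f (x - e i).

Lemma poly_op_neq0 (R : nzRingType) (T : Type) (p : {poly R}) A f (x : T) :
  poly_op p A f x != 0 -> exists2 k, (k < size p)%N & iter k A f x != 0.
Proof.
apply: contra_neqP => iter_eq0; apply: big1 => k _.
have [->|iter_neq0] := eqVneq (iter k A f x) 0; first exact: mulr0.
by case: iter_eq0; exists k.
Qed.

Lemma pairing_poly_op (R : comNzRingType) (T : finType) (g : T -> R)
    (A : (T -> R) -> T -> R) m p f :
  (forall h, pairing g (A h) = m * pairing g h) ->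
  pairing g (poly_op p A f) = p.[m] * pairing g f.
Proof.
move=> gA; have g_iter k : pairing g (iter k A f) = m ^+ k * pairing g f.
  by elim: k => [|k IH]; rewrite ?mul1r // gA IH exprS mulrA.
rewrite pairing_sumr horner_coef mulr_suml; apply: eq_bigr => k _.
by rewrite pairingZr g_iter mulrA.
Qed.

Lemma pairing_cayley_adjacency (R : numDomainType) (G : finZmodType)
    (I : finType) (e : I -> G) (g f : G -> R) :
  unitary_character g ->
  pairing g (cayley_adjacency e f) = (\sum_i g (e i)) * pairing g f.
Proof.
move=> [gM _]; rewrite pairing_sumr mulr_suml; apply: eq_bigr => i _.
rewrite /pairing (reindex_inj (addIr (e i))) mulr_sumr; apply: eq_bigr => x _.
by rewrite /= addrK gM mulrCA mulrA.
Qed.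

Lemma sum_unitary_character_bounds (R : realDomainType) (G : nmodType)
    (I : finType) (e : I -> G) (g : G -> R) i :
  unitary_character g -> g (e i) != 1 ->
  - #|I|%:R <= \sum_j g (e j) <= #|I|%:R - 2.
Proof.
move=> [_ g1] gi.
have g_bounds j : -1 <= g (e j) <= 1 by rewrite -ler_norml g1.
have cardE : #|I|%:R = \sum_(j : I) 1 :> R by rewrite sumr_const.
have giN : g (e i) = -1.
  have /eqP := g1 (e i); rewrite eqr_norml ler01 andbT (negPf gi).
  by move/eqP.
apply/andP; split.
  by rewrite cardE -sumrN; apply: ler_sum => j _; case/andP: (g_bounds j).
rewrite cardE (bigD1 i) //= [in leRHS](bigD1 i) //= giN.
have : \sum_(j | j != i) g (e j) <= \sum_(j | j != i) 1.
  by apply: ler_sum => j _; case/andP: (g_bounds j).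
by lra.
Qed.

Section Hamming.
Variables (V : pzRingType) (n : nat).
Implicit Types x y c : 'rV[V]_n.

Definition weight x : nat := \sum_i (x 0 i != 0)%R.

Lemma weight0 : weight 0 = 0%N.
Proof. by apply: big1 => i _; rewrite mxE eqxx. Qed.

Lemma weightD x y : (weight (x + y) <= weight x + weight y)%N.
Proof.
rewrite -big_split leq_sum // => i _; rewrite mxE.
have [->|_] := eqVneq (x 0 i) 0; first by rewrite add0r.
exact: leq_trans (leq_b1 _) (leq_addr _ _).
Qed.

Lemma weight_delta_le1 i : (weight 'e_i <= 1)%N.
Proof.
rewrite /weight (bigD1 i) //= big1 => [|j /negPf ji]; first by case: (_ != _).
by rewrite mxE ji andbF eqxx.
Qed.

Lemma iter_cayley_adjacency_neq0 (R : nzSemiRingType) k c x :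
  iter k (cayley_adjacency (fun i => 'e_i)) (point_mass c) x != 0 :> R ->
  (weight (x - c) <= k)%N.
Proof.
elim: k x => [|k IH] x /=.
  rewrite /point_mass; have [->|_] := eqVneq x c; last by rewrite eqxx.
  by rewrite subrr weight0.
apply: contra_neqT; rewrite -ltnNge => kx; apply: big1 => i _.
apply: contraTeq kx => /IH; rewrite -leqNgt => xk.
rewrite (_ : x - c = (x - 'e_i - c) + 'e_i); last by rewrite addrAC subrK.
by rewrite (leq_trans (weightD _ _)) // -[k.+1]addn1 leq_add ?weight_delta_le1.
Qed.

End Hamming.

Definition hamming_ball (V : finPzRingType) n (c : 'rV[V]_n) d :
    {set 'rV[V]_n} :=
  [set x | weight (x - c) <= d]%N.

Lemma Z2_neq0 (a : 'Z_2) : a != 0 -> a = 1.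
Proof. by case: a => -[|[|//]] // ? _; apply/val_inj. Qed.

Lemma cube_addxx n (x : 'rV['Z_2]_n) : x + x = 0.
Proof. by apply/rowP => i; rewrite !mxE addrr_pchar2 // pchar_Fp. Qed.
Arguments cube_addxx {n} x.

Definition sign2 (R : pzRingType) (a : 'Z_2) : R := (-1) ^+ a.

Section CubeCharacters.
Variables (R : numDomainType) (n : nat).
Local Notation G := 'rV['Z_2]_n.
Implicit Types (f g : G -> R) (x y : G).

Lemma sign2D a b : sign2 R (a + b) = sign2 R a * sign2 R b.
Proof.
by rewrite /sign2 -exprD -signr_odd -[RHS]signr_odd -modn2 modn_mod modn2.
Qed.

Lemma norm_sign2 a : `|sign2 R a| = 1.
Proof. by rewrite normrX normrN1 expr1n. Qed.

Definition chi y x : R := sign2 R ((x *m y^T) 0 0).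

Lemma chi_unitary_character y : unitary_character (chi y).
Proof.
split=> [x z|x]; last exact: norm_sign2.
by rewrite /chi mulmxDl mxE sign2D.
Qed.

Lemma chiC y x : chi y x = chi x y.
Proof.
rewrite /chi (_ : y *m x^T = (x *m y^T)^T); last by rewrite trmx_mul trmxK.
by rewrite [in RHS]mxE.
Qed.

Lemma chi_delta i x : chi 'e_i x = sign2 R (x 0 i).
Proof. by rewrite /chi trmx_delta -colE mxE. Qed.

Lemma sum_chi x : \sum_y chi y x = (x == 0)%:R *+ #|{: G}|.
Proof.
have [->|/rV0Pn[i xi]] := eqVneq x 0.
  rewrite mulr1n -sumr_const; apply: eq_bigr => y _.
  by rewrite (unitary_character0 (chi_unitary_character y)).
have flip : chi 'e_i x = -1 by rewrite chi_delta (Z2_neq0 xi).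
have sum_opp : \sum_y chi y x = - \sum_y chi y x.
  rewrite [LHS](reindex_inj (addrI 'e_i)) /= -sumrN.
  apply: eq_bigr => y _.
  by rewrite chiC (chi_unitary_character x).1 [chi x _]chiC flip mulN1r chiC.
by apply/eqP; move/eqP: sum_opp; rewrite mul0rn -addr_eq0 -mulr2n mulrn_eq0.
Qed.

Lemma fourier_inversion f x :
  f x *+ #|{: G}| = \sum_y chi y x * pairing (chi y) f.
Proof.
under [RHS]eq_bigr do rewrite mulr_sumr.
rewrite exchange_big -(pairing_point_mass f) pairingC -sumrMnl /=.
apply: eq_bigr => z _.
under eq_bigr do rewrite mulrA -(chi_unitary_character _).1.
rewrite -mulr_suml sum_chi addr_eq0 (oppr_exponent2 cube_addxx) eq_sym.
by rewrite mulrnAl.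
Qed.

Lemma unitary_character_trivial g : unitary_character g ->
  (forall i, g 'e_i = 1) -> forall x, g x = 1.
Proof.
move=> gP g1 x; have g0 := unitary_character0 gP.
rewrite [x]row_sum_delta (big_morph g gP.1 g0).
apply: big1 => i _; have [->|/Z2_neq0->] := eqVneq (x 0 i) 0.
  by rewrite scale0r g0.
by rewrite scale1r.
Qed.

End CubeCharacters.

Section ClassesAsCones.
Variables (R : realType) (G : finZmodType).
Implicit Types (A : {set G}) (f : G -> R).

Lemma classS_dual_cone A f : classS A f <->
  (exists x, f x != 0) /\ dual_cone (sign_constraints (~: A) (~: A)) f.
Proof.
rewrite dual_cone_sign_constraints; split=> [[f_neq0 fA]|[f_neq0 [fP fN]]].
  by split=> //; split=> x; rewrite inE => /fA->.
by split=> // x xA; apply/eqP; rewrite eq_le fP ?fN // inE.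
Qed.

Lemma classSpm_dual_cone A f : classSpm A f <->
  (exists x, f x != 0) /\ dual_cone (sign_constraints A (~: A)) f.
Proof.
rewrite dual_cone_sign_constraints; split=> [[f_neq0 fN fP]|[f_neq0 [fP fN]]].
  by split=> //; split=> // x; rewrite inE => /fN.
by split=> // x xA; apply: fN; rewrite inE.
Qed.

Lemma classSpm_pairing_le A w f :
  (forall x, x \in A -> x != 0 -> w x <= 0) ->
  (forall x, x \notin A -> 0 <= w x) ->
  classSpm A f -> pairing w f <= w 0 * f 0.
Proof.
move=> wA wC [_ fN fP]; rewrite /pairing (bigD1 0) //= gerDl.
apply: sumr_le0 => x x0; have [xA|xA] := boolP (x \in A).
  by rewrite mulr_le0_ge0 ?wA ?fP.
by rewrite mulr_ge0_le0 ?wC ?fN.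
Qed.

End ClassesAsCones.

Section Minima.
Variables (R : realType) (n : nat).
Local Notation G := 'rV['Z_2]_n.
Implicit Types (f : G -> R) (L : set (G -> R)) (A P N : {set G}).

Lemma fourier_nonneg_norm_le f x : fourier_nonneg f -> `|f x| <= f 0.
Proof.
move=> fhat_ge0; have G_gt0 : (0 < #|{: G}|)%N by apply/card_gt0P; exists 0.
rewrite -(ler_pMn2r G_gt0) -normrMn !fourier_inversion.
apply: le_trans (ler_norm_sum _ _ _) _; apply: ler_sum => y _.
have chiP := chi_unitary_character R y.
rewrite normrM chiP.2 (unitary_character0 chiP) ger0_norm //.
exact: fourier_nonneg_pairing fhat_ge0 chiP.
Qed.

Lemma ratios_has_minimum L (S : (G -> R) -> Prop) :
  dual_cone L (point_mass 0) ->
  (forall f, S f <-> (exists x, f x != 0) /\ dual_cone L f) ->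
  exists l, is_minimum (ratios S) l.
Proof.
move=> L0 SE; pose C := (L `|` @unitary_character R G)%classic.
have CE f : dual_cone C f <-> dual_cone L f /\ fourier_nonneg f.
  by rewrite dual_coneU -(fourier_nonneg_exponent2 cube_addxx).
have C0 : dual_cone C (point_mass 0).
  apply/dual_coneU; split=> // g gP.
  by rewrite pairing_point_mass (unitary_character0 gP).
have C_bounded f : dual_cone C f -> forall x, `|f x| <= f 0.
  by move=> /CE[_ fhat_ge0] x; exact: fourier_nonneg_norm_le.
have point_mass00 : (point_mass 0 : G -> R) 0 = 1 by rewrite /point_mass eqxx.
have [f0 [/CE[Lf0 f0hat_ge0] f00 f0max]] :=
  dual_cone_ratio_max (fun=> 1) C_bounded
    (ex_intro2 _ _ _ C0 point_mass00).
have sum_f0_gt0 : 0 < \sum_x f0 x.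
  have := f0max _ C0; rewrite pairing_point_mass pairing1l point_mass00 mul1r.
  exact: lt_le_trans.
exists (\sum_x f0 x)^-1; split.
  apply/ratiosP; exists f0; split; rewrite ?f00 ?mul1r //.
  by apply/SE; split=> //; exists 0; rewrite f00 oner_eq0.
move=> r /ratiosP[f [/SE[_ Lf] fhat_ge0 sum_gt0 ->]].
rewrite ler_pdivlMr // mulrC ler_pdivrMr // -!pairing1l.
by apply/f0max/CE.
Qed.

Lemma dual_cone_sign_constraints_point_mass0 P N : 0 \notin N ->
  dual_cone (sign_constraints P N) (point_mass 0 : G -> R).
Proof.
move=> N0; apply/dual_cone_sign_constraints; split=> x xM; first exact: ler0n.
by rewrite /point_mass; case: eqVneq xM N0 => // -> ->.
Qed.

Lemma is_lambda_exists A : 0 \in A -> exists l : R, is_lambda A l.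
Proof.
move=> A0; apply: ratios_has_minimum (@classS_dual_cone R G A).
by apply: dual_cone_sign_constraints_point_mass0; rewrite inE A0.
Qed.

Lemma is_lambda_pm_exists A : 0 \in A -> exists l : R, is_lambda_pm A l.
Proof.
move=> A0; apply: ratios_has_minimum (@classSpm_dual_cone R G A).
by apply: dual_cone_sign_constraints_point_mass0; rewrite inE A0.
Qed.

End Minima.

Section DistanceToOnes.
Variable n : nat.
Local Notation ones := (const_mx 1 : 'rV['Z_2]_n).

Lemma sum_sign2_distance (R : pzRingType) (x : 'rV['Z_2]_n) :
  \sum_i sign2 R (x 0 i) + n%:R = 2 * (weight (x - ones))%:R.
Proof.
have -> : n%:R = \sum_(i < n) 1 :> R by rewrite sumr_const card_ord.
rewrite natr_sum mulr_sumr -big_split; apply: eq_bigr => i _ /=.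
rewrite !mxE subr_eq0 /sign2; case: (x 0 i) => -[|[|//]] ? /=.
  by rewrite mulr1.
by rewrite mulr0 addNr.
Qed.

Lemma weight_subr0_ones : weight (0 - ones) = n.
Proof.
rewrite -[RHS]card_ord -sum1_card; apply: eq_bigr => i _.
by rewrite !mxE sub0r oppr_eq0 oner_eq0.
Qed.

End DistanceToOnes.

Definition antipodal_set n d : {set 'rV['Z_2]_n} :=
  0 |: hamming_ball (const_mx 1) d.

Section AntipodalSet.
Variables (R : realType) (n d : nat).
Local Notation G := 'rV['Z_2]_n.
Local Notation ones := (const_mx 1 : G).
Implicit Types (f g : G -> R) (x : G).

Lemma antipodal_weak_duality f :
  classSpm (antipodal_set n d) f -> fourier_nonneg f ->
  (n%:R - 2 * d%:R) * \sum_x f x <= (2 * n%:R - 2 * d%:R) * f 0.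
Proof.
move=> fA fhat_ge0; pose w x : R := \sum_i chi R 'e_i x + (n%:R - 2 * d%:R).
have wE x : w x = 2 * (weight (x - ones))%:R - 2 * d%:R.
  by rewrite /w addrA -sum_sign2_distance; under eq_bigr do rewrite chi_delta.
apply: (@le_trans _ _ (pairing w f)).
  rewrite pairingC pairingDr pairing_sumr mulrC mulr_suml lerDr.
  apply: sumr_ge0 => i _; rewrite pairingC.
  exact: fourier_nonneg_pairing fhat_ge0 (chi_unitary_character R _).
have -> : 2 * n%:R - 2 * d%:R = w 0 by rewrite wE weight_subr0_ones.
apply: classSpm_pairing_le fA => x; rewrite !inE wE.
  by move=> /predU1P[->|xd]; rewrite ?eqxx // subr_le0 ler_pM2l ?ler_nat.
rewrite negb_or -ltnNge => /andP[_ xd].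
by rewrite subr_ge0 ler_pM2l // ler_nat ltnW.
Qed.

Lemma is_lambda_pm_antipodal_ge (l : R) : (0 < n)%N ->
  is_lambda_pm (antipodal_set n d) l -> 2^-1 - d%:R / n%:R <= l.
Proof.
move=> n_gt0 [/ratiosP[f [fA fhat_ge0 sum_gt0 ->]] _].
have n0 : 0 < n%:R :> R by rewrite ltr0n.
have f0_ge0 : 0 <= f 0 by exact: le_trans (fourier_nonneg_norm_le 0 fhat_ge0).
have -> : 2^-1 - d%:R / n%:R = (n%:R - 2 * d%:R) / (2 * n%:R) :> R.
  by field; rewrite gt_eqF.
rewrite ler_pdivrMr ?mulr_gt0 // mulrAC ler_pdivlMr //.
apply: le_trans (antipodal_weak_duality fA fhat_ge0) _.
by rewrite mulrC ler_wpM2l // gerDl oppr_le0 mulr_ge0.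
Qed.

Definition chebyshev_kernel : G -> R :=
  poly_op (rescaled_chebyshev R n d) (cayley_adjacency (fun i => 'e_i))
    (point_mass ones).

Lemma chebyshev_kernel_eq0 x :
  (d < weight (x - ones))%N -> chebyshev_kernel x = 0.
Proof.
rewrite ltnNge; apply: contraNeq => kernel_neq0.
have [k k_lt /iter_cayley_adjacency_neq0 xk] := poly_op_neq0 kernel_neq0.
by rewrite (leq_trans xk) // -ltnS (leq_trans k_lt) // size_rescaled_chebyshev.
Qed.

Definition turan_witness : G -> R := point_mass 0 \+ chebyshev_kernel.

Lemma pairing_turan_witness g : unitary_character g ->
  pairing g turan_witness =
  1 + (rescaled_chebyshev R n d).[\sum_i g 'e_i] * g ones.
Proof.
move=> gP; have gA f := pairing_cayley_adjacency (fun i => 'e_i : G) f gP.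
rewrite pairingDr (pairing_poly_op _ _ gA) !pairing_point_mass.
by rewrite unitary_character0.
Qed.

Lemma turan_witness_fourier_nonneg : (0 < n)%N -> fourier_nonneg turan_witness.
Proof.
move=> n0; apply/(fourier_nonneg_exponent2 cube_addxx) => g gP.
rewrite pairing_turan_witness //.
have [/existsP[i gi]|] := boolP [exists i, g 'e_i != 1].
  have := sum_unitary_character_bounds gP gi; rewrite card_ord.
  move=> /(rescaled_chebyshev_le1 d n0).
  rewrite -[leLHS]mulr1 -(gP.2 ones) -normrM ler_norml => /andP[lb _].
  by rewrite -lerBlDl sub0r.
rewrite negb_exists => /forallP g1.
have {}g1 x : g x = 1.
  by apply: unitary_character_trivial => // i; apply/eqP/negPn/g1.
rewrite g1 mulr1; under eq_bigr do rewrite g1.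
rewrite sumr_const card_ord addr_ge0 //.
apply: le_trans (rescaled_chebyshev_growth R d n0).
by rewrite addr_ge0 // mulr_ge0 ?sqr_ge0 ?divr_ge0.
Qed.

Lemma sum_turan_witness : (0 < n)%N ->
  2 + d%:R ^+ 2 * (2 / n%:R) <= \sum_x turan_witness x.
Proof.
move=> n0; rewrite -pairing1l pairing_turan_witness; last first.
  exact: unitary_character_const1.
rewrite /= mulr1 sumr_const card_ord.
by have := rescaled_chebyshev_growth R d n0; lra.
Qed.

Lemma turan_witness_eq0 x : x \notin antipodal_set n d -> turan_witness x = 0.
Proof.
rewrite !inE negb_or -ltnNge => /andP[/negPf x0 xd].
by rewrite /turan_witness /= /point_mass x0 chebyshev_kernel_eq0 ?addr0.
Qed.

Lemma turan_witness0 : (d < n)%N -> turan_witness 0 = 1.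
Proof.
move=> dn; rewrite /turan_witness /= chebyshev_kernel_eq0.
  by rewrite /point_mass eqxx addr0.
by rewrite weight_subr0_ones.
Qed.

Lemma is_lambda_antipodal_le (l : R) : (d < n)%N ->
  is_lambda (antipodal_set n d) l -> l <= (2 + d%:R ^+ 2 * (2 / n%:R))^-1.
Proof.
move=> dn [_ l_le]; have n0 : (0 < n)%N by exact: leq_ltn_trans dn.
have bound_gt0 : 0 < 2 + d%:R ^+ 2 * (2 / n%:R) :> R.
  by rewrite ltr_pwDl // mulr_ge0 ?sqr_ge0 ?divr_ge0.
have sum_ge := sum_turan_witness n0.
have sum_gt0 := lt_le_trans bound_gt0 sum_ge.
apply: (@le_trans _ _ (turan_witness 0 / \sum_x turan_witness x)).
  apply/l_le/ratiosP; exists turan_witness; split => //.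
    split; last exact: turan_witness_eq0.
    by exists 0; rewrite turan_witness0 ?oner_eq0.
  exact: turan_witness_fourier_nonneg.
by rewrite turan_witness0 // mul1r lef_pV2 ?posrE.
Qed.

End AntipodalSet.

Lemma eventually_exists_degree (R : realType) (eps : R) : 0 < eps ->
  exists N, forall n, (N <= n)%N -> exists d,
    [/\ (d < n)%N, d%:R / n%:R < eps
      & (2 + d%:R ^+ 2 * (2 / n%:R))^-1 < eps].
Proof.
move=> eps_gt0.
have [m m_gt1 m_eps] : exists2 m : nat, (1 < m)%N & m%:R^-1 < eps.
  exists (Num.bound eps^-1).+2 => //.
  rewrite invf_plt ?posrE ?ltr0n //.
  apply: lt_trans (archi_boundP _) _; first by rewrite invr_ge0 ltW.
  by rewrite ltr_nat.
exists (m ^ 3)%N => n mn; exists (n %/ m)%N; set d := (n %/ m)%N.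
have m_gt0 : (0 < m)%N by exact: ltnW.
have n_gt0 : (0 < n)%N by apply: leq_trans mn; rewrite expn_gt0 m_gt0.
have dm_le : (d * m <= n)%N by exact: leq_trunc_div.
have m2_le : (m ^ 2 <= d)%N by rewrite leq_divRL // -expnSr.
have n_lt : (n < d.+1 * m)%N by exact: ltn_ceil.
have m0 : 0 < m%:R :> R by rewrite ltr0n.
have n0 : 0 < n%:R :> R by rewrite ltr0n.
split; first exact: ltn_Pdiv.
  apply: le_lt_trans m_eps.
  by rewrite ler_pdivrMr // ler_pdivlMl // -natrM ler_nat mulnC.
apply: lt_trans m_eps.
have mn_le : (m * n <= d ^ 2 * 2)%N by nia.
have : m%:R <= d%:R ^+ 2 * (2 / n%:R) :> R.
  by rewrite mulrA ler_pdivlMr // -natrX -!natrM ler_nat.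
move=> m_le; have lt_bound : m%:R < 2 + d%:R ^+ 2 * (2 / n%:R) :> R by lra.
by rewrite ltf_pV2 ?posrE // (lt_trans m0).
Qed.

Theorem theorem1p6 (R : realType) (eps : R) (eps_gt0 : 0 < eps) :
  exists N : nat, forall n : nat, (N <= n)%N ->
  exists A : {set 'rV['Z_2]_n},
    standard A /\
    exists l lpm : R,
      [/\ is_lambda A l, is_lambda_pm A lpm, l < eps & lpm > 2^-1 - eps].
Proof.
have [N degree] := eventually_exists_degree eps_gt0.
exists N => n /degree[d [dn d_small d_large]].
have A0 : 0 \in antipodal_set n d by exact: setU11.
exists (antipodal_set n d); split.
  exact: standard_exponent2 cube_addxx _ A0.
have [l lP] := is_lambda_exists R A0.
have [lpm lpmP] := is_lambda_pm_exists R A0.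
exists l, lpm; split => //.
  exact: le_lt_trans (is_lambda_antipodal_le dn lP) d_large.
have := is_lambda_pm_antipodal_ge (leq_ltn_trans (leq0n d) dn) lpmP.
by apply: lt_le_trans; rewrite ltrD2l ltrN2.
Qed.
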